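(* Let $(x_n)_n$ be a Parseval frame for a Hilbert space $H$ that is not an orthonormal basis. Suppose that $\|x_i\|=1$ for some index $i$. Then there exist an index $j\neq i$ such that $\|x_j\|<1$ and a Parseval frame $(x_n')_n$ for $H$ with the properties $\|x_i'\|<1$, $\|x_j'\|<1$, and $x_n'=x_n$ for all $n\neq i,j$.
   Context: Convention: $H$ is a complex Hilbert space; sequences $(x_n)_n$ are indexed by a set $J$, where either $J=\mathbb{N}=\{1,2,\ldots\}$ and $H$ is infinite-dimensional and separable, or $J=\{1,\ldots,M\}$ for some $M\in\mathbb N$ and $H$ is finite-dimensional. The sequence $(x_n)_n$ is a Parseval frame for $H$ if $\sum_n|\langle x,x_n\rangle|^2=\|x\|^2$ for all $x\in H$. *)

(* Defs.v *)
From mathcomp Require Export all_boot all_order all_algebra sesquilinear.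
From mathcomp Require Export complex.
From mathcomp Require Export all_classical all_reals all_analysis.

Set Implicit Arguments.
Unset Strict Implicit.
Unset Printing Implicit Defensive.
Import Order.TTheory GRing.Theory Num.Theory.

Local Open Scope classical_set_scope.
Local Open Scope ring_scope.
Local Open Scope complex_scope.

(* A complex Hilbert space is a complete normed module H over R[i] with a
   positive definite Hermitian form, linear in its first argument, that induces
   the norm. The norm takes its values in R[i]; as z < t in R[i] forces z and t
   to have the same imaginary part, `|x| < 1 is the usual comparison of reals. *)
Definition induces_norm (R : realType) (H : completeNormedModType R[i])
    (dot : {dot H for @Num.conj R[i]}) : Prop :=
  forall x : H, `|x| ^+ 2 = dot x x.

Definition finite_dimensional (R : realType) (H : completeNormedModType R[i])
    : Prop :=
  exists (d : nat) (b : 'I_d -> H),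
    forall x : H, exists c : 'I_d -> R[i], x = \sum_(k < d) c k *: b k.

Definition separable (T : topologicalType) : Prop :=
  exists D : set T, countable D /\ dense D.

(* None stands for the index set of all the naturals (numbered from 0 instead
   of 1), and Some M for a set of M indices. *)
Definition index_set (J : option nat) : choiceType :=
  if J is Some M then 'I_M : choiceType else nat : choiceType.

Definition index_fits (R : realType) (J : option nat)
    (H : completeNormedModType R[i]) : Prop :=
  match J with
  | Some M => (0 < M)%N /\ finite_dimensional H
  | None => ~ finite_dimensional H /\ separable H
  end.

Section Frames.
Variables (R : realType) (H : completeNormedModType R[i]).
Variables (dot : {dot H for @Num.conj R[i]}) (J : choiceType).

(* The terms are nonnegative reals, so the unordered sum is the sum of the
   series when J is nat and the finite sum when J is finite. *)
Definition Parseval_frame (x : J -> H) : Prop :=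
  forall y : H,
    (\esum_(n in [set: J]) (complex.Re (`|dot y (x n)| ^+ 2))%:E)%E =
    (complex.Re (`|y| ^+ 2))%:E.

Definition linear_span (x : J -> H) : set H :=
  [set y | exists (s : seq J) (c : J -> R[i]), y = \sum_(n <- s) c n *: x n].

Definition orthonormal_basis (x : J -> H) : Prop :=
  (forall m n : J, dot (x m) (x n) = (m == n)%:R) /\ dense (linear_span x).

End Frames.

(* Main.v *)
(* If every |x n| were 1, Bessel's inequality for the vector x m and the indices
   m, n would make the frame orthonormal, and a Parseval frame spans densely.
   So some |x j| < 1; the same inequality makes x i orthogonal to x j, and
   rotating the pair (x i, x j) by an angle with cosine 3/5 and sine 4/5 keeps
   the frame Parseval while it averages the two squared norms. *)
Require Import Defs.
From mathcomp Require Import ring.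
Import Order.TTheory GRing.Theory Num.Theory.

Local Open Scope ring_scope.
Local Open Scope complex_scope.

Section ParsevalFrames.
Local Open Scope classical_set_scope.
Local Open Scope ring_scope.
Variables (R : realType) (H : completeNormedModType R[i]).
Variables (dot : {dot H for @Num.conj R[i]}) (dot_norm : induces_norm dot).
Variables (J : choiceType).
Implicit Types (x : J -> H) (y : H).

(** Nonnegative elements of [R[i]] have zero imaginary part. This carries inequalities between the
    extended real sums and [R[i]]. *)
Lemma Re_le_ge0 (z t : R[i]) : 0 <= z -> 0 <= t ->
  (complex.Re z <= complex.Re t) = (z <= t).
Proof. by move=> /ger0_Im z0 /ger0_Im t0; rewrite lecE z0 t0 eqxx. Qed.

Lemma sum_Re_EFin (I : Type) (s : seq I) (f : I -> R[i]) :
  (\sum_(n <- s) (complex.Re (f n))%:E)%E = (complex.Re (\sum_(n <- s) f n))%:E.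
Proof.
elim: s => [|a s IH]; first by rewrite !big_nil.
by rewrite !big_cons IH -EFinD; case: (f a) (\sum_(n <- s) f n) => ? ? [].
Qed.

(** The unordered sum is a supremum over finite index sets, and [s] is one of them. *)
Lemma Parseval_frame_bessel x y (s : seq J) : Parseval_frame dot x -> uniq s ->
  \sum_(n <- s) `|dot y (x n)| ^+ 2 <= `|y| ^+ 2.
Proof.
move=> xP us; rewrite -Re_le_ge0 ?exprn_ge0//; last first.
  by apply: sumr_ge0 => n _; rewrite exprn_ge0.
rewrite -lee_fin -sum_Re_EFin -(xP y); apply: esum_ge.
by exists [set` s]; [split => //; exact: finite_seq | rewrite -fsbig_seq].
Qed.

Lemma Parseval_frame_approx x y (e : R[i]) : Parseval_frame dot x -> 0 < e ->
  exists2 s : seq J, uniq s & `|y| ^+ 2 - \sum_(n <- s) `|dot y (x n)| ^+ 2 < e.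
Proof.
move=> xP e0.
have Re0 : 0 < complex.Re e by move: e0; rewrite ltcE => /andP[].
have := xP y; rewrite /esum => supE.
have finsup : (ereal_sup [set (\sum_(n \in A) (complex.Re (`|dot y (x n)| ^+ 2))%:E)%E
    | A in fsets [set: J]]) \is a fin_num by rewrite supE.
have [_ [A [finA _] <-]] := ub_ereal_sup_adherent Re0 finsup.
rewrite supE fsbig_finite// sum_Re_EFin -EFinB lte_fin => lt_sum.
exists (finmap.enum_fset (fset_set A)); first exact: finmap.fset_uniq.
set S := \sum_(n <- _) _ in lt_sum *.
have S0 : 0 <= S by apply: sumr_ge0 => n _; rewrite exprn_ge0.
have y0 : 0 <= `|y| ^+ 2 by rewrite exprn_ge0.
(* [lt_sum] compares real parts only; it lifts to [R[i]] because all three imaginary parts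
   vanish. *)
move: (ger0_Im S0) (ger0_Im y0) (ger0_Im (ltW e0)) lt_sum.
case: (S) => a b; case: (`|y| ^+ 2) => c d; case: (e) => u v /= -> -> ->.
by rewrite ltcE /= subr0 eqxx /= ltrBlDl -ltrBlDr.
Qed.

(** Bessel's inequality for the vector [x n] and the single index [n] bounds the fourth power of its
    norm by the square. *)
Lemma Parseval_frame_le1 x n : Parseval_frame dot x -> `|x n| <= 1.
Proof.
move=> xP; have := Parseval_frame_bessel x (x n) _ xP (isT : uniq [:: n]).
rewrite big_seq1 -dot_norm normrX normr_id.
have [->|xn0] := eqVneq `|x n| 0; first by rewrite ler01.
have xn_gt0 : 0 < `|x n| ^+ 2 by rewrite exprn_gt0// lt_def xn0 normr_ge0.
by rewrite expr2 -[leRHS]mulr1 ler_pM2l// expr_le1.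
Qed.

Lemma Parseval_frame_unit_orthogonal x i n : Parseval_frame dot x ->
  `|x i| = 1 -> n != i -> dot (x i) (x n) = 0.
Proof.
move=> xP xi1 ni.
have us : uniq [:: i; n] by rewrite /= inE eq_sym ni.
have := Parseval_frame_bessel x (x i) _ xP us.
rewrite big_cons big_seq1 -dot_norm xi1 expr1n normr1 expr1n gerDl => le0.
have /eqP : `|dot (x i) (x n)| ^+ 2 = 0.
  by apply: le_anti; rewrite le0 exprn_ge0.
by rewrite sqrf_eq0 normr_eq0 => /eqP.
Qed.

Lemma dotDl a b c : dot (a + b) c = dot a c + dot b c.
Proof. by rewrite linearDl. Qed.

Lemma dotBl a b c : dot (a - b) c = dot a c - dot b c.
Proof. by rewrite linearBl. Qed.

Lemma dotZl k a b : dot (k *: a) b = k * dot a b.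
Proof. by rewrite linearZl_LR. Qed.

Lemma dotDr a b c : dot a (b + c) = dot a b + dot a c.
Proof. by rewrite linearDr. Qed.

Lemma dotBr a b c : dot a (b - c) = dot a b - dot a c.
Proof. by rewrite linearBr. Qed.

Lemma dotZr k a b : dot a (k *: b) = Num.conj k * dot a b.
Proof. by rewrite linearZr_LR. Qed.

Lemma dot_suml (I : Type) (s : seq I) (f : I -> H) b :
  dot (\sum_(n <- s) f n) b = \sum_(n <- s) dot (f n) b.
Proof. by rewrite linear_sumlz. Qed.

Lemma dot_sumr (I : Type) (s : seq I) a (f : I -> H) :
  dot a (\sum_(n <- s) f n) = \sum_(n <- s) dot a (f n).
Proof. by rewrite linear_sumr. Qed.

Lemma dot_conj a b : Num.conj (dot a b) = dot b a.
Proof. by rewrite [RHS]hermC expr0 mul1r. Qed.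

(** Pythagoras: the partial expansion [z] has the same coefficients as [y] on [s], so [y - z] is
    orthogonal to [z]. *)
Lemma sqr_norm_sub_expansion x y (s : seq J) : uniq s ->
  (forall m n, dot (x m) (x n) = (m == n)%:R) ->
  `|y - \sum_(n <- s) dot y (x n) *: x n| ^+ 2 =
    `|y| ^+ 2 - \sum_(n <- s) `|dot y (x n)| ^+ 2.
Proof.
move=> us xo; set z := \sum_(n <- s) _.
have zx n : n \in s -> dot z (x n) = dot y (x n).
  move=> ns; rewrite /z dot_suml (bigD1_seq n)//= dotZl xo eqxx mulr1.
  by rewrite big1 ?addr0// => m mn; rewrite dotZl xo (negPf mn) mulr0.
have yz0 : dot (y - z) z = 0.
  rewrite {2}/z dot_sumr big_seq big1// => n ns.
  by rewrite dotZr dotBl zx// subrr mulr0.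
rewrite !dot_norm dotBr yz0 subr0 dotBl; congr (_ - _).
rewrite /z dot_suml; apply: eq_bigr => n _.
by rewrite dotZl -(dot_conj y) normCK.
Qed.

Lemma unit_Parseval_frame_orthonormal_basis x : Parseval_frame dot x ->
  (forall n, `|x n| = 1) -> orthonormal_basis dot x.
Proof.
move=> xP x1.
have xo m n : dot (x m) (x n) = (m == n)%:R.
  have [->|mn] := eqVneq m n; first by rewrite -dot_norm x1 expr1n.
  by apply: Parseval_frame_unit_orthogonal; rewrite // eq_sym.
split=> // O [y Oy] oO.
have /nbhs_ballP[e /= e0 yeO] : nbhs y O by exact: open_nbhs_nbhs.
(* The tolerance is [e ^+ 2] because the gap in the Parseval sum is the squared distance from [y] to
   its partial expansion. *)
have [s us lts] := Parseval_frame_approx x y _ xP (exprn_gt0 2 e0).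
exists (\sum_(n <- s) dot y (x n) *: x n); split; last first.
  by exists s, (fun n => dot y (x n)).
apply: yeO; rewrite -ball_normE /ball_ /=.
by rewrite -(@ltr_pXn2r _ 2) ?nnegrE ?(ltW e0)// sqr_norm_sub_expansion.
Qed.

(** A sum of nonnegative terms splits over [i], [j] and the remaining indices, where the two
    families agree. *)
Lemma Parseval_frame_exchange x x' i j : i != j -> Parseval_frame dot x ->
  (forall n, n <> i -> n <> j -> x' n = x n) ->
  (forall y, `|dot y (x' i)| ^+ 2 + `|dot y (x' j)| ^+ 2 =
             `|dot y (x i)| ^+ 2 + `|dot y (x j)| ^+ 2) ->
  Parseval_frame dot x'.
Proof.
move=> ij xP x'E x'ij y; rewrite -(xP y).
have w0 (v : J -> H) n : (0 <= (complex.Re (`|dot y (v n)| ^+ 2))%:E)%E.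
  have : 0 <= `|dot y (v n)| ^+ 2 by rewrite exprn_ge0.
  by rewrite lecE lee_fin => /andP[].
rewrite (esumID [set` [:: i; j]])//; rewrite [RHS](esumID [set` [:: i; j]])//.
have us : uniq [:: i; j] by rewrite /= inE ij.
congr (_ + _)%E; last first.
  apply: eq_esum => n [_ /= nij]; rewrite x'E// => ?; apply: nij; subst n.
    by rewrite inE eqxx.
  by rewrite !inE eqxx orbT.
rewrite !setTI !esum_fset//.
by rewrite -!fsbig_seq// !sum_Re_EFin !big_cons !big_nil !addr0 x'ij.
Qed.

Lemma conjC_realC (r : R) : Num.conj (r%:C : R[i]) = r%:C.
Proof. by apply: CrealP; rewrite complex_real. Qed.

Lemma sqr_norm_dot_rotation (c s : R) (a b y : H) : c ^+ 2 + s ^+ 2 = 1 ->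
  `|dot y (c%:C *: a + s%:C *: b)| ^+ 2 + `|dot y (c%:C *: b - s%:C *: a)| ^+ 2 =
    `|dot y a| ^+ 2 + `|dot y b| ^+ 2.
Proof.
move=> cs; have csC : c%:C ^+ 2 + s%:C ^+ 2 = 1 :> R[i].
  by rewrite -!rmorphXn -rmorphD cs.
rewrite dotBr dotDr !dotZr !normCK !conjC_realC rmorphB rmorphD !rmorphM.
rewrite /= !conjC_realC.
set u := dot y a; set v := dot y b.
(* As [c] and [s] are real, conjugation fixes them and the cross terms of the two squares cancel. *)
transitivity ((c%:C ^+ 2 + s%:C ^+ 2) * (u * Num.conj u + v * Num.conj v)).
  ring.
by rewrite csC mul1r.
Qed.

(** By orthogonality the squared norm is [c ^+ 2 + s ^+ 2 * |b| ^+ 2]. A nonzero [s] makes it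
    strictly smaller than [c ^+ 2 + s ^+ 2]. *)
Lemma norm_orthogonal_combination_lt1 (c s : R) (a b : H) :
  c ^+ 2 + s ^+ 2 = 1 -> s != 0 -> dot a b = 0 -> `|a| = 1 -> `|b| < 1 ->
  `|c%:C *: a + s%:C *: b| < 1.
Proof.
move=> cs s0 ab0 a1 b1.
have ba0 : dot b a = 0 by rewrite -dot_conj ab0 conjC0.
rewrite -(@expr_lt1 _ 2)// dot_norm dotDr !dotDl !dotZr !dotZl !conjC_realC.
rewrite ab0 ba0 -!dot_norm a1 !mulr0 addr0 add0r expr1n mulr1.
have s2 : 0 < s%:C ^+ 2 :> R[i].
  by rewrite -rmorphXn ltcR lt_def sqrf_eq0 s0 sqr_ge0.
have -> : (1 : R[i]) = c%:C ^+ 2 + s%:C ^+ 2.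
  by rewrite -!rmorphXn -rmorphD cs.
by rewrite -expr2 ltrD2l mulrA -expr2 -[ltRHS]mulr1 ltr_pM2l// expr_lt1.
Qed.

End ParsevalFrames.

Theorem lemma4p4 (R : realType) (H : completeNormedModType R[i])
    (dot : {dot H for @Num.conj R[i]}) (dot_norm : induces_norm dot)
    (J : option nat) (JH : index_fits J H)
    (x : index_set J -> H) (x_frame : Parseval_frame dot x)
    (x_not_onb : ~ orthonormal_basis dot x)
    (i : index_set J) (xi1 : `|x i| = 1) :
  exists j : index_set J,
    j <> i /\ `|x j| < 1 /\
    exists x' : index_set J -> H,
      Parseval_frame dot x' /\ `|x' i| < 1 /\ `|x' j| < 1 /\
      forall n : index_set J, n <> i -> n <> j -> x' n = x n.
Proof.
have [j xj1] : exists j, `|x j| <> 1.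
  apply/existsNP => x1; apply: x_not_onb.
  exact: unit_Parseval_frame_orthonormal_basis.
have {}xj1 : `|x j| < 1.
  by rewrite lt_neqAle (Parseval_frame_le1 _ _ _ dot_norm _ _ _ x_frame) andbT; apply/eqP.
have ji : j != i by apply: contraTneq xj1 => ->; rewrite xi1 ltxx.
have xij : dot (x i) (x j) = 0.
  exact: Parseval_frame_unit_orthogonal x_frame xi1 ji.
(* The Pythagorean triple 3, 4, 5 gives a rational point of the unit circle with both coordinates
   nonzero: [s0] serves [x' i] and [c0] serves [x' j]. *)
pose c : R := 3 / 5; pose s : R := 4 / 5.
have cs : c ^+ 2 + s ^+ 2 = 1 by rewrite /c /s; field.
have c0 : c != 0 by rewrite mulf_neq0 ?invr_eq0 ?pnatr_eq0.
have s0 : s != 0 by rewrite mulf_neq0 ?invr_eq0 ?pnatr_eq0.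
pose x' n := if n == i then c%:C *: x i + s%:C *: x j
             else if n == j then c%:C *: x j - s%:C *: x i else x n.
have x'i : x' i = c%:C *: x i + s%:C *: x j by rewrite /x' eqxx.
have x'j : x' j = c%:C *: x j - s%:C *: x i by rewrite /x' (negPf ji) eqxx.
have x'E n : n <> i -> n <> j -> x' n = x n.
  by rewrite /x' => /eqP/negPf -> /eqP/negPf ->.
exists j; split; first exact/eqP.
split=> //; exists x'; split.
  apply: (Parseval_frame_exchange _ _ _ _ x _ i j _ x_frame x'E); first by rewrite eq_sym.
  by move=> y; rewrite x'i x'j sqr_norm_dot_rotation.
split; first by rewrite x'i; apply: (norm_orthogonal_combination_lt1 _ _ _ dot_norm).
(* Written as [- s] times [x i] plus [c] times [x j], the second vector falls under the same norm
   bound, with [- s] and [c] as the coefficients. *)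
split=> //; rewrite x'j addrC -scaleNr -rmorphN.
apply: (norm_orthogonal_combination_lt1 _ _ _ dot_norm) => //.
by rewrite sqrrN addrC.
Qed.
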